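(* Let $\vec{\gamma}=(\gamma_1,\dots,\gamma_K)$ and $\vec{\delta}=(\delta_1,\dots,\delta_L)$ be vectors of positive integers such that $\gamma_k\neq\delta_l$ for all $1\le k\le K$ and $1\le l\le L$. Assume that $$v(\lambda;\vec{\gamma},\vec{\delta})=\frac{\prod_{k=1}^{K} H_{\gamma_k}(\lambda)}{\prod_{l=1}^{L} H_{\delta_l}(\lambda)}$$ is an integer for all partitions $\lambda$, that $\sum_{k=1}^{K}\frac{1}{\gamma_k}=\sum_{l=1}^{L}\frac{1}{\delta_l}$, and that $L-K=1$. Then $K=1$ (and thus $L=2$), and $2\gamma_1=\delta_1=\delta_2$.
   Context: A partition $\lambda=(\lambda_1,\dots,\lambda_d)$ is a weakly decreasing finite sequence of positive integers (possibly empty), identified with its Young diagram. For a box $\square$ of the Young diagram, the hook based at $\square$ is the set of boxes consisting of $\square$ itself, the boxes of the diagram exactly to the right of $\square$ in its row, and the boxes exactly below $\square$ in its column. The hook length $h(\square)$ is the number of boxes in this hook. Let $\mathcal{H}(\lambda)$ denote the multiset of hook lengths of all boxes of $\lambda$. For a positive integer $r$, define the multiset (with repetitions) $\mathcal{H}_r(\lambda)=\{h/r : h\in\mathcal{H}(\lambda),\ r\mid h\}$, and let $H_r(\lambda)$ be the product of the elements of $\mathcal{H}_r(\lambda)$, counted with multiplicity (the empty product is $1$). *)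

(* Defs.v *)
From mathcomp Require Import all_boot all_order all_algebra.

Set Implicit Arguments.
Unset Strict Implicit.
Unset Printing Implicit Defensive.

Import GRing.Theory Num.Theory.
Local Open Scope nat_scope.

Definition is_partition (la : seq nat) : bool :=
  sorted geq la && all (ltn 0) la.

(* A box is a pair (row, column), both numbered from 0 (English convention:
   row i + 1 lies below row i); no box is listed twice. *)
Definition boxes (la : seq nat) : seq (nat * nat) :=
  [seq (i, j) | i <- iota 0 (size la), j <- iota 0 (nth 0 la i)].

Definition hook (la : seq nat) (b : nat * nat) : seq (nat * nat) :=
  [seq c <- boxes la |
     (c.1 == b.1) && (b.2 <= c.2) || (c.2 == b.2) && (b.1 <= c.1)].

Definition hook_length (la : seq nat) (b : nat * nat) : nat :=
  size (hook la b).

(* Multisets of natural numbers are represented by sequences; only the product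
   of the elements, which does not depend on the order, is used below. *)
Definition hook_lengths (la : seq nat) : seq nat :=
  [seq hook_length la b | b <- boxes la].

Definition hook_lengths_div (r : nat) (la : seq nat) : seq nat :=
  [seq h %/ r | h <- hook_lengths la & r %| h].

Definition hook_prod (r : nat) (la : seq nat) : nat :=
  \prod_(h <- hook_lengths_div r la) h.

Definition hook_ratio (K L : nat) (gamma : K.-tuple nat) (delta : L.-tuple nat)
    (la : seq nat) : rat :=
  ((\prod_(k < K) (hook_prod (tnth gamma k) la)%:R)
     / (\prod_(l < L) (hook_prod (tnth delta l) la)%:R))%R.

(* Main.v *)
Require Import Defs.
From mathcomp Require Import all_boot all_order all_algebra.
From mathcomp Require Import zify ring.

Set Implicit Arguments.
Unset Strict Implicit.
Unset Printing Implicit Defensive.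

Import Order.TTheory GRing.Theory Num.Theory.

(** Write c(n) for the number of gamma_k dividing n minus the number of
    delta_l dividing n.  The function c on the integers is even and periodic,
    c(0) = K - L = -1, and its mean over a period is
    sum 1/gamma_k - sum 1/delta_l = 0.

    A partition is encoded by the set T of hook lengths of its first column;
    its hook lengths are then the differences x - y > 0 with x in T and y not
    in T ([hook_lengths_partition_of]).  Given a finite set S of positive
    integers and a large prime p, let T consist of the multiples p * x with
    x in S together with all small enough non-multiples of p.  The hook lengths
    divisible by p are then p times those encoded by S, none is divisible by
    p ^ 2, and comparing p-adic valuations in the integer v shows that the sum
    of c(x - y) over x in S and y < x outside S is nonnegative for every S
    ([gap_count_le], [excess_ge0]).

    Since c is even and has mean zero, twice that sum equals a term linear in S
    minus the quadratic form sum of c(x - y) over x, y in S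
    ([gap_sum_form]).  Both depend on S modulo the period only, and S may meet
    a residue class in any number of points, so the quadratic term can be made
    to dominate: -c is a positive semidefinite function on the cyclic group of
    residues ([signed_form_le0]).

    As -c takes integer values and equals 1 at 0, semidefiniteness on three
    points forces its values to lie in {-1, 0, 1} and makes every point h with
    c(h) = -1 (resp. 1) a period (resp. an antiperiod).  Let h be the least
    of the gamma_k and delta_l; c vanishes strictly between 0 and h but
    not at h.  Were h a period, c would be nonpositive and could not have mean
    zero; so h is an antiperiod, that is, c(n) = [h | n] - 2 [2h | n]
    ([c_classification]).  A multiset of positive integers is determined by how
    many of its members divide each n ([count_divisors_inj]); as no gamma_k is
    a delta_l, gamma is (h) and delta is (2h, 2h). *)

(** * Hook lengths as differences *)

Local Open Scope nat_scope.

(** The hook lengths of the first column, in decreasing order. *)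
Fixpoint first_column (la : seq nat) : seq nat :=
  if la is a :: l then (a + size l) :: first_column l else [::].

Fixpoint partition_of (T : seq nat) : seq nat :=
  if T is x :: T' then (x - size T') :: partition_of T' else [::].

Lemma boxes_cons a l :
  boxes (a :: l) =
  [seq (0, j) | j <- iota 0 a] ++ [seq (b.1.+1, b.2) | b <- boxes l].
Proof.
rewrite /boxes /= -[1]/(1 + 0) iotaDl; congr (_ ++ _).
by rewrite map_flatten -!map_comp; congr flatten; apply: eq_map => i /=;
  rewrite -map_comp.
Qed.

Lemma count_geq_iota j a : count (leq j) (iota 0 a) = a - j.
Proof.
elim: a => [|a IH]; first by rewrite sub0n.
by rewrite -addn1 iotaD count_cat IH /=; case: leqP; lia.
Qed.

Lemma count_boxes_col l j :
  count (fun c => c.2 == j) (boxes l) = count (ltn j) l.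
Proof.
elim: l => // a l IH; rewrite boxes_cons count_cat !count_map /= -IH.
congr (_ + _); rewrite (eq_count (a2 := pred1 j)) //.
by rewrite count_uniq_mem ?iota_uniq // mem_iota.
Qed.

Lemma hook_length_row0 a l j : hook_length (a :: l) (0, j) =
  (a - j) + count (ltn j) l.
Proof.
rewrite /hook_length /hook size_filter boxes_cons count_cat !count_map.
rewrite -(count_geq_iota j) -count_boxes_col.
congr (_ + _); apply: eq_count => c /=; lia.
Qed.

Lemma hook_length_below a l b :
  hook_length (a :: l) (b.1.+1, b.2) = hook_length l b.
Proof.
rewrite /hook_length /hook !size_filter boxes_cons count_cat !count_map.
rewrite (eq_count (a2 := pred0)) ?count_pred0; last by move=> c /=; lia.
by apply: eq_count => c.
Qed.

Lemma first_column_lt a l x :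
  path geq a l -> x \in first_column l -> x < a + size l.
Proof.
elim: l a => // b l IH a /= /andP[ba bl]; rewrite inE => /orP[/eqP->|xl].
  by move: ba => /=; lia.
by have := IH _ bl xl; move: ba => /=; lia.
Qed.

(** The box in column [j] of a row of length [a] placed on top of [l] has hook
    length [a + size l] minus the [j]-th member of the left-hand sequence.
    These members enumerate the gaps of [first_column l] because passing from
    column [j] to [j + 1] skips one integer for each row of length
    [j + 1]. *)
Lemma first_column_gaps a l : path geq a l ->
  [seq j + count (geq j) l | j <- iota 0 a] =
  [seq y <- iota 0 (a + size l) | y \notin first_column l].
Proof.
elim: l a => [|b l IH] a /=.
  move=> _; rewrite addn0 filter_predT; apply: map_id_in => j _ /=.
  by rewrite addn0.
case/andP=> ba bl.
have -> : a + (size l).+1 = (b + size l) + (1 + (a - b)) by move: ba => /=; lia.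
rewrite {1}(_ : a = b + (a - b)); last by move: ba => /=; lia.
rewrite (iotaD 0 b (a - b)) (iotaD 0 (b + size l)) (iotaD _ 1).
rewrite !filter_cat map_cat /= inE eqxx /=; congr (_ ++ _).
  transitivity [seq y <- iota 0 (b + size l) | y \notin first_column l].
    rewrite -IH //; apply/eq_in_map => j; rewrite mem_iota /= => jb.
    by rewrite leqNgt jb.
  apply: eq_in_filter => y; rewrite mem_iota /= inE => yb.
  by rewrite (_ : (y == _) = false) //; lia.
rewrite (_ : [seq y <- _ | _] = iota (0 + (b + size l) + 1) (a - b));
  last first.
  apply/all_filterP/allP => y; rewrite mem_iota inE negb_or => yb.
  apply/andP; split; first by lia.
  by apply/negP => /(first_column_lt bl); lia.
have -> : 0 + (b + size l) + 1 = (size l).+1 + b by lia.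
rewrite (iotaDl (size l).+1) add0n; apply/eq_in_map => j.
rewrite mem_iota => /andP[bj _].
have -> : count (geq j) l = size l; last by move: bj => /=; lia.
apply/eqP; rewrite -all_count; apply/allP => x xl.
have := order_path_min (rev_trans leq_trans) bl => /allP/(_ x xl) /= ; lia.
Qed.

(** Removing the top row does not change the hooks of the other rows; this is
    why hook lengths can be studied by recursion on the list of parts. *)
Lemma hook_lengths_cons a l : path geq a l -> hook_lengths (a :: l) =
  [seq a + size l - y | y <- iota 0 (a + size l) & y \notin first_column l]
    ++ hook_lengths l.
Proof.
move=> al; rewrite /hook_lengths boxes_cons map_cat -first_column_gaps //.
rewrite -!map_comp; congr (_ ++ _).
  apply/eq_in_map => j; rewrite mem_iota /= => ja.
  rewrite hook_length_row0; have := count_predC (geq j) l.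
  rewrite (@eq_count _ (predC (geq j)) (ltn j)) => [|x];
    last by rewrite /= ltnNge.
  by move: (count _ _) (count _ _) => u v; lia.
by apply: eq_map => b; exact: hook_length_below.
Qed.

Lemma size_partition_of T : size (partition_of T) = size T.
Proof. by elim: T => //= x T ->. Qed.

Lemma size_lt_head x T : path gtn x T -> 0 \notin x :: T -> size T < x.
Proof.
elim: T x => [|y T IH] x /=; first by rewrite inE; lia.
case/andP=> yx yT; rewrite inE negb_or => /andP[_ T0].
by have := IH y yT T0; move: yx => /=; lia.
Qed.

Lemma partition_ofP T : sorted gtn T -> 0 \notin T ->
  is_partition (partition_of T) /\ first_column (partition_of T) = T.
Proof.
elim: T => // x T IH /= xT T0.
have szT := size_lt_head xT T0.
have [] := IH (path_sorted xT).
  by move: T0; rewrite inE negb_or => /andP[].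
rewrite /is_partition /= => /andP[sT pT] ->.
rewrite size_partition_of subnK; last by lia.
split=> //; rewrite pT subn_gt0 szT /= andbT.
case: T xT szT T0 {IH pT} sT => //= y T /andP[yx _] szT _ ->.
by rewrite andbT; move: yx => /=; lia.
Qed.

Lemma hook_lengths_partition_of T : sorted gtn T -> 0 \notin T ->
  hook_lengths (partition_of T) =
  [seq x - y | x <- T, y <- [seq y <- iota 0 x | y \notin T]].
Proof.
elim: T => // x T IH xT xT0.
have [/andP[srt _] _] := partition_ofP xT xT0.
have sT := path_sorted xT.
have T0 : 0 \notin T by move: xT0; rewrite inE negb_or => /andP[].
have Tx y : y \in T -> y < x.
  by move=> yT; have /allP/(_ y yT) := order_path_min (rev_trans ltn_trans) xT.
rewrite [partition_of _]/= hook_lengths_cons // IH // (partition_ofP sT T0).2.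
rewrite size_partition_of subnK; last by have := size_lt_head xT xT0; lia.
rewrite /=; congr (_ ++ _).
  congr map; apply: eq_in_filter => y; rewrite mem_iota inE /= => yx.
  by rewrite (_ : (y == x) = false) //; lia.
congr flatten; apply/eq_in_map => z zT; congr map.
apply: eq_in_filter => y; rewrite mem_iota inE /= => yz.
by rewrite (_ : (y == x) = false) //; have := Tx _ zT; lia.
Qed.

(** * Selecting the hooks divisible by a large prime *)

Definition gap_sum (R : nmodType) (T : seq nat) (f : nat -> R) : R :=
  (\sum_(x <- T) \sum_(0 <= y < x | y \notin T) f (x - y)%N)%R.

Lemma sum_hook_lengths (R : nmodType) T (f : nat -> R) :
  sorted gtn T -> 0 \notin T ->
  (\sum_(h <- hook_lengths (partition_of T)) f h)%R = gap_sum T f.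
Proof.
move=> sT T0; rewrite hook_lengths_partition_of // big_allpairs_dep /=.
by apply: eq_bigr => x _; rewrite big_filter /index_iota subn0.
Qed.

(** Residue classes other than that of 0 are filled up from below, so that no
    difference divisible by [p] between a member and a smaller non-member
    occurs in them. *)
Definition dilate p X (S : seq nat) : seq nat :=
  rev [seq z <- iota 0 (p * X) | (p %| z) ==> (z %/ p \in S)].

Lemma sum_multiples (R : nmodType) p X (f : nat -> R) : 0 < p ->
  (\sum_(0 <= z < p * X | (p %| z)%N) f z = \sum_(0 <= z < X) f (p * z)%N)%R.
Proof.
move=> p0; elim: X => [|X IH]; first by rewrite muln0 !big_nil.
rewrite big_nat_recr //= -IH mulnSr.
rewrite (big_cat_nat (n := p * X)) //=; last by lia.
congr (_ + _)%R; rewrite big_ltn_cond; last by lia.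
rewrite dvdn_mulr // big1_seq ?addr0 // => z /andP[/dvdnP[q ->]].
by rewrite mem_index_iota (mulnC q) -mulnSr !ltn_pmul2l //; lia.
Qed.

Lemma sum_subseq_iota (R : nmodType) X S (f : nat -> R) :
  uniq S -> {in S, forall x, x < X} ->
  (\sum_(x <- S) f x = \sum_(0 <= x < X | x \in S) f x)%R.
Proof.
move=> uS SX; rewrite -[RHS]big_filter; apply/perm_big/uniq_perm => //.
  by rewrite filter_uniq ?iota_uniq.
move=> x; rewrite mem_filter mem_index_iota.
by case: (boolP (x \in S)) => // /SX.
Qed.

Lemma mem_dilate p X S z :
  (z \in dilate p X S) = ((p %| z) ==> (z %/ p \in S)) && (z < p * X).
Proof. by rewrite mem_rev mem_filter mem_iota. Qed.

Lemma gap_sum_dilate (R : nmodType) p X S (f : nat -> R) :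
  0 < p -> uniq S -> {in S, forall x, x < X} ->
  (forall d, ~~ (p %| d) -> f d = 0%R) ->
  gap_sum (dilate p X S) f = gap_sum S (fun d => f (p * d)).
Proof.
move=> p0 uS SX f0.
rewrite /gap_sum (sum_subseq_iota (X := p * X)); last 2 first.
- by rewrite rev_uniq filter_uniq ?iota_uniq.
- by move=> x; rewrite mem_dilate => /andP[].
rewrite (sum_subseq_iota (X := X)) //.
transitivity (\sum_(0 <= z < p * X | (p %| z)%N)
   if (z %/ p)%N \in S then
     \sum_(0 <= y < z | (p %| y)%N) if (y %/ p)%N \in S then 0 else f (z - y)%N
   else 0)%R.
  rewrite big_mkcond [RHS]big_mkcond; apply: eq_big_nat => z /andP[_ zX].
  rewrite mem_dilate zX andbT.
  have gapE y : y < z ->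
      (y \notin dilate p X S) = (p %| y) && (y %/ p \notin S).
    by move=> yz; rewrite mem_dilate (ltn_trans yz zX) andbT negb_imply.
  case: (boolP (p %| z)) => pz /=.
    case: ifP => // _; rewrite big_mkcond [RHS]big_mkcond.
    apply: eq_big_nat => y /andP[_ yz].
    by rewrite gapE //; case: (p %| y); case: (_ \in S).
  rewrite big1_seq // => y /andP[+]; rewrite mem_index_iota => + /andP[_ yz].
  rewrite gapE // => /andP[py _]; apply: f0; apply: contra pz => pd.
  by rewrite -(subnK (ltnW yz)) dvdn_add.
rewrite sum_multiples // [RHS]big_mkcond; apply: eq_bigr => x _.
rewrite mulKn //; case: ifP => // _.
rewrite sum_multiples // [RHS]big_mkcond; apply: eq_bigr => y _.
by rewrite mulKn // -mulnBr; case: (_ \in S).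
Qed.

Lemma dilate_sorted p X S : sorted gtn (dilate p X S).
Proof.
rewrite rev_sorted; apply: sorted_filter; first exact: ltn_trans.
exact: iota_ltn_sorted.
Qed.

Lemma logn_small p h : prime p -> 0 < h < p * p -> logn p h = (p %| h).
Proof.
move=> pp /andP[h0 hp]; rewrite lognE pp h0 /=; case: ifP => // ph.
rewrite lognE pp /=; case: andP => // -[q0 qp].
have := dvdn_leq q0 qp; rewrite leq_divRL ?prime_gt0 //; lia.
Qed.

Lemma hook_prodE r la :
  hook_prod r la = \prod_(h <- hook_lengths la | r %| h) (h %/ r).
Proof. by rewrite /hook_prod big_map big_filter. Qed.

Lemma hook_prod_gt0 r la : 0 < r -> 0 < hook_prod r la.
Proof.
move=> r0; rewrite hook_prodE big_seq_cond.
apply big_ind => // [x y|h /andP[/mapP[b bla ->] rh]].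
  by rewrite muln_gt0 => ->.
have hook_gt0 : 0 < hook_length la b.
  rewrite /hook_length size_filter -has_count; apply/hasP.
  by exists b; rewrite ?eqxx ?leqnn.
by rewrite divn_gt0 // dvdn_leq.
Qed.

Lemma logn_hook_prod p r la : prime p -> 0 < r < p ->
  {in hook_lengths la, forall h, 0 < h < p * p} ->
  logn p (hook_prod r la) = \sum_(h <- hook_lengths la) ((p %| h) && (r %| h)).
Proof.
move=> pp /andP[r0 rp]; rewrite hook_prodE.
have lr : logn p r = 0.
  by rewrite lognE pp r0 /=; case: ifP => // /(dvdn_leq r0); lia.
elim: (hook_lengths la) => [|h hs IH] hsP; first by rewrite !big_nil logn1.
have hh := hsP h (mem_head _ _).
have hsP' : {in hs, forall h, 0 < h < p * p}.
  by move=> x xs; apply: hsP; rewrite inE xs orbT.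
rewrite !big_cons -IH //; case: ifP => rh; last by rewrite andbF.
have h0 : 0 < h %/ r by rewrite divn_gt0 // dvdn_leq //; case/andP: hh.
rewrite lognM //.
  by rewrite logn_div // lr subn0 (logn_small pp hh) andbT.
rewrite big_seq_cond; apply big_ind => // [x y|x /andP[xs rx]].
  by rewrite muln_gt0 => ->.
by rewrite divn_gt0 // dvdn_leq //; have /andP[] := hsP' x xs.
Qed.

Lemma logn_prod (I : eqType) p (s : seq I) (F : I -> nat) :
  {in s, forall i, 0 < F i} ->
  logn p (\prod_(i <- s) F i) = \sum_(i <- s) logn p (F i).
Proof.
elim: s => [|i s IH] F0; first by rewrite !big_nil logn1.
have F0' : {in s, forall i, 0 < F i} by move=> j js; rewrite F0 // inE js orbT.
rewrite !big_cons lognM ?IH //; first by rewrite F0 ?mem_head.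
by rewrite big_seq; apply big_ind => // x y; rewrite muln_gt0 => ->.
Qed.

Section Divisibility.

Variables gs ds : seq nat.
Hypothesis gs_gt0 : all (ltn 0) gs.
Hypothesis ds_gt0 : all (ltn 0) ds.
Hypothesis dvd_hook_prod : forall la, is_partition la ->
  \prod_(d <- ds) hook_prod d la %| \prod_(g <- gs) hook_prod g la.

(** For [p] larger than every member of [S] and every [r] in [gs ++ ds], the
    [p]-adic valuation of [hook_prod r] at the partition encoded by
    [dilate p X S] is exactly the number of hooks divisible by [r] of the partition encoded by
    [S]. *)
Lemma gap_count_le S : uniq S -> 0 \notin S ->
  \sum_(d <- ds) gap_sum S (fun n => nat_of_bool (d %| n))
    <= \sum_(g <- gs) gap_sum S (fun n => nat_of_bool (g %| n)).
Proof.
move=> uS S0.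
pose X := (\sum_(x <- S) x).+1.
have SX : {in S, forall x, x < X}.
  by move=> x xS; rewrite ltnS (big_rem x xS) leq_addr.
(* One prime above X and above all r makes hooks smaller than p ^ 2 and every
   r coprime to p. *)
have [p pX pp] := prime_above (X + \sum_(r <- gs ++ ds) r).
have rp r : r \in gs ++ ds -> 0 < r < p.
  move=> rs; apply/andP; split.
    by move: rs; rewrite mem_cat => /orP[/(allP gs_gt0)|/(allP ds_gt0)].
  by move: pX; rewrite (big_rem r rs) /=; lia.
have p0 := prime_gt0 pp.
set T := dilate p X S; set la := partition_of T.
have sT : sorted gtn T := dilate_sorted p X S.
have T0 : 0 \notin T by rewrite mem_dilate dvdn0 div0n (negbTE S0).
have [la_part _] := partition_ofP sT T0.
have hookP : {in hook_lengths la, forall h, 0 < h < p * p}.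
  rewrite /la hook_lengths_partition_of // => h /allpairsPdep[x [y []]].
  rewrite mem_dilate mem_filter mem_iota => /andP[_ xX] /andP[_ yx] ->.
  have : p * X <= p * p by rewrite leq_mul2l; lia.
  by lia.
have countE r : r \in gs ++ ds ->
    logn p (hook_prod r la) = gap_sum S (fun n => nat_of_bool (r %| n)).
  move=> /rp rp'; rewrite logn_hook_prod // sum_hook_lengths //.
  rewrite gap_sum_dilate //; last by move=> d /negbTE ->.
  apply: eq_bigr => x _; apply: eq_bigr => y _.
  rewrite dvdn_mulr //= Gauss_dvdr // coprime_sym prime_coprime //.
  by apply/negP => /dvdn_leq; case/andP: rp' => r0; rewrite r0; lia.
have hp0 r : r \in gs ++ ds -> 0 < hook_prod r la.
  by move=> /rp /andP[r0 _]; exact: hook_prod_gt0.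
have g0 : {in gs, forall g, 0 < hook_prod g la}.
  by move=> g gg; rewrite hp0 // mem_cat gg.
have d0 : {in ds, forall d, 0 < hook_prod d la}.
  by move=> d dd; rewrite hp0 // mem_cat dd orbT.
have le : logn p (\prod_(d <- ds) hook_prod d la)
    <= logn p (\prod_(g <- gs) hook_prod g la).
  apply: dvdn_leq_log; last exact: dvd_hook_prod.
  by rewrite big_seq; apply big_ind => // x y; rewrite muln_gt0 => ->.
have sumE s : {subset s <= gs ++ ds} ->
    \sum_(r <- s) logn p (hook_prod r la)
    = \sum_(r <- s) gap_sum S (fun n => nat_of_bool (r %| n)).
  by move=> ss; apply: eq_big_seq => r /ss/countE.
rewrite -!sumE ?(logn_prod p d0) ?(logn_prod p g0) // in le *.
  by move=> r rs; rewrite mem_cat rs.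
by move=> r rs; rewrite mem_cat rs orbT.
Qed.

End Divisibility.

(** * Semidefiniteness of a periodic function *)

Local Open Scope ring_scope.

Section QuadraticForm.

Variables (c : int -> int) (M : nat).
Hypothesis M_gt0 : (0 < M)%N.
Hypothesis c_even : forall z, c (- z) = c z.
Hypothesis c_per : forall z, c (z + M%:Z) = c z.
Hypothesis c_mean : forall z, \sum_(0 <= d < M) c (z + d%:Z) = 0.
Hypothesis c_gap : forall S, uniq S -> 0%N \notin S ->
  0 <= gap_sum S (fun n => c n%:Z).

Definition form (u v : seq nat) : int :=
  \sum_(x <- u) \sum_(y <- v) c (x%:Z - y%:Z).

(** The contribution of [x] to the linear part of twice [gap_sum].  It is
    periodic because [c] has mean zero. *)
Definition potential (x : nat) : int :=
  2 * (\sum_(0 <= y < x) c (x%:Z - y%:Z)) + c 0.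

Lemma form_sym u v : form u v = form v u.
Proof.
rewrite /form exchange_big; apply: eq_bigr => x _; apply: eq_bigr => y _.
by rewrite -c_even opprB.
Qed.

Lemma form_catl u1 u2 v : form (u1 ++ u2) v = form u1 v + form u2 v.
Proof. by rewrite /form big_cat. Qed.

Lemma form_catr u v1 v2 : form u (v1 ++ v2) = form u v1 + form u v2.
Proof. by rewrite form_sym form_catl !(form_sym _ u). Qed.

Lemma form_cons x u v : form (x :: u) v = form [:: x] v + form u v.
Proof. by rewrite -cat1s form_catl. Qed.

Lemma form_consr u x v : form u (x :: v) = form u [:: x] + form u v.
Proof. by rewrite -cat1s form_catr. Qed.

(** The non-members [y < x] are all [y < x] except the members, and by evenness
    the sum over pairs of members [y < x] is half of the off-diagonal part of
    [form S S]; the diagonal is compensated by the [c 0] in [potential]. *)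
Lemma gap_sum_form S : sorted gtn S ->
  2 * gap_sum S (fun n => c n%:Z) = \sum_(x <- S) potential x - form S S.
Proof.
elim: S => [|x S IH] xS; first by rewrite /gap_sum /form !big_nil mulr0 subr0.
have Sx y : y \in S -> (y < x)%N.
  by move=> yS; have /allP/(_ y yS) := order_path_min (rev_trans ltn_trans) xS.
have uS : uniq S.
  by apply: (sorted_uniq (rev_trans ltn_trans) ltnn); exact: path_sorted xS.
have gapE : gap_sum (x :: S) (fun n => c n%:Z) =
    (\sum_(0 <= y < x) c (x%:Z - y%:Z) - form [:: x] S)
    + gap_sum S (fun n => c n%:Z).
  rewrite /gap_sum /form big_seq1 big_cons; congr (_ + _).
    apply/eqP; rewrite eq_sym subr_eq addrC (sum_subseq_iota _ uS Sx).
    rewrite (bigID (fun y => y \in S)) /=; apply/eqP; congr (_ + _).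
    rewrite big_nat_cond [RHS]big_nat_cond; apply: eq_big => [y|y].
      by rewrite inE; case: (y =P x) => // ->; rewrite ltnn andbF.
    by move=> /andP[/andP[_ yx] _]; rewrite subzn // ltnW.
  rewrite big_seq [RHS]big_seq; apply: eq_bigr => z zS.
  rewrite big_nat_cond [RHS]big_nat_cond; apply: eq_bigl => y.
  rewrite inE; case: (y =P x) => // ->.
  by rewrite [(x < z)%N]ltnNge (ltnW (Sx z zS)).
rewrite gapE mulrDr IH ?(path_sorted xS) // big_cons.
rewrite (form_cons x S (x :: S)) !(form_consr _ x S) (form_sym S [:: x]).
rewrite /potential.
have -> : form [:: x] [:: x] = c 0 by rewrite /form !big_seq1 subrr.
by ring.
Qed.

Lemma c_periodic z k : c (z + (k * M)%N%:Z) = c z.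
Proof.
elim: k => [|k IH]; first by rewrite mul0n addr0.
by rewrite mulSn addnC PoszD addrA c_per.
Qed.

Lemma potential_per x k : potential (x + k * M) = potential x.
Proof.
elim: k => [|k <-]; first by rewrite addn0.
have -> : (x + k.+1 * M = M + (x + k * M))%N by rewrite mulSn addnCA.
move: (x + k * M)%N => y.
rewrite /potential (big_cat_nat (n := M)) //=; last by rewrite leq_addr.
have -> : \sum_(0 <= d < M) c ((M + y)%N%:Z - d%:Z) = 0.
  rewrite -[RHS](c_mean (- (M + y)%N%:Z)); apply: eq_bigr => d _.
  by rewrite -c_even opprB addrC.
rewrite add0r -{1}[M]add0n big_addn addKn; congr (_ * _ + _).
apply: eq_bigr => d _; congr c.
by rewrite !PoszD; ring.
Qed.

(** Realizes a list of residues with repetitions by a decreasing list of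
    positive integers, placing each entry in a period of its own. *)
Fixpoint lift (w : seq nat) : seq nat :=
  if w is x :: w' then (x %% M + size w * M)%N :: lift w' else [::].

Lemma lift_lt w x : x \in lift w -> (M <= x < (size w).+1 * M)%N.
Proof.
elim: w => //= y w IH; rewrite inE => /orP[/eqP->|/IH].
  by have := ltn_pmod y M_gt0; rewrite !mulSn; lia.
by rewrite !mulSn; lia.
Qed.

Lemma lift_sorted w : sorted gtn (lift w).
Proof.
elim: w => //= y w IH.
rewrite path_min_sorted //; apply/allP => x /lift_lt /= .
by rewrite !mulSn; lia.
Qed.

Lemma c_lift x k z : c ((x %% M + k * M)%N%:Z - z) = c (x%:Z - z).
Proof.
have -> : (x %% M + k * M)%N%:Z - z = ((x %% M)%N%:Z - z) + (k * M)%N%:Z.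
  by rewrite PoszD; ring.
rewrite c_periodic -(c_periodic _ (x %/ M)); congr c.
by rewrite {3}(divn_eq x M) PoszD; ring.
Qed.

Lemma form_liftl w v : form (lift w) v = form w v.
Proof.
elim: w => [|x w IH] //=; rewrite form_cons IH [RHS]form_cons /form !big_seq1.
by congr (_ + _); apply: eq_bigr => y _; rewrite c_lift.
Qed.

Lemma potential_lift w :
  \sum_(x <- lift w) potential x = \sum_(x <- w) potential x.
Proof.
elim: w => [|x w IH] //=; rewrite !big_cons IH potential_per.
by rewrite {2}(divn_eq x M) addnC potential_per.
Qed.

(** Both sides depend only on residues, so [w] may have repetitions although
    [gap_sum] is about sets. *)
Lemma form_le_potential w : form w w <= \sum_(x <- w) potential x.
Proof.
rewrite -potential_lift -form_liftl form_sym -form_liftl -subr_ge0.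
have sw := lift_sorted w; rewrite -gap_sum_form // mulr_ge0 // c_gap //.
  exact: (sorted_uniq (rev_trans ltn_trans) ltnn).
by apply/negP => /lift_lt; lia.
Qed.

(** Repeating [w] [R] times multiplies the form by [R ^ 2] but the potential
    only by [R]; a positive value of the form would violate
    [form_le_potential] for large [R]. *)
Lemma form_le0 w : form w w <= 0.
Proof.
set b := \sum_(x <- w) potential x.
pose rw R := flatten (nseq R w).
have rwl R v : form (rw R) v = R%:Z * form w v.
  elim: R => [|R IH]; first by rewrite /form big_nil mul0r.
  by rewrite [rw _]/= form_catl IH -addn1 PoszD; ring.
have rwp R : \sum_(x <- rw R) potential x = R%:Z * b.
  elim: R => [|R IH]; first by rewrite big_nil mul0r.
  by rewrite [rw _]/= big_cat IH -/b -addn1 PoszD /=; ring.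
have := form_le_potential (rw `|b|.+1%N).
rewrite rwl form_sym rwl rwp; move: (form w w) => a; nia.
Qed.

(** The complement of one residue in a full period has the effect of that
    residue with coefficient -1, since constant vectors lie in the kernel of
    the form. *)
Definition complements (v : seq nat) : seq nat :=
  flatten [seq rem (d %% M)%N (iota 0 M) | d <- v].

Lemma form_complementsl u v : form (complements u) v = - form u v.
Proof.
elim: u => [|d u IH]; first by rewrite /form !big_nil oppr0.
rewrite [complements _]/= form_catl IH form_cons opprD; congr (_ + _).
have zero : form (iota 0 M) v = 0.
  rewrite form_sym /form big1 // => x _.
  rewrite -[RHS](c_mean (- x%:Z)) /index_iota subn0.
  by apply: eq_bigr => y _; rewrite -c_even opprB addrC.
have dM : (d %% M)%N \in iota 0 M by rewrite mem_iota ltn_pmod.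
move: zero; rewrite /form (big_rem _ dM) /= big_seq1 => /eqP.
rewrite addrC addr_eq0 => /eqP ->; congr (- _); apply: eq_bigr => y _.
by rewrite -(c_lift d 0) mul0n addn0.
Qed.

(** The left side is the form at the vector [u - v]: the semidefiniteness of
    [form_le0] extends from multisets of residues to signed vectors. *)
Lemma signed_form_le0 u v : form u u - 2 * form u v + form v v <= 0.
Proof.
have := form_le0 (u ++ complements v).
rewrite !form_catl !form_catr !form_complementsl (form_sym u (complements v)).
rewrite (form_sym v (complements v)) !form_complementsl (form_sym v u).
by congr (_ <= _); ring.
Qed.

Hypothesis c0 : c 0 = -1.

Lemma c_le1 (x : nat) : -1 <= c x%:Z <= 1.
Proof.
have := signed_form_le0 [:: 0%N; x] [::].
have := signed_form_le0 [:: 0%N] [:: x].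
rewrite /form !big_cons !big_nil !subrr !sub0r !subr0 c_even c0; lia.
Qed.

(** In the Gram matrix of -c on the points 0, h, h + e the vector
    (1, -1, 0) is isotropic, hence in the kernel; testing it plus and minus
    the third basis vector suffices because the values are integers. *)
Lemma c_shift_neg (h e : nat) : c h%:Z = -1 -> c (h + e)%N%:Z = c e%:Z.
Proof.
move=> ch.
have := signed_form_le0 [:: 0%N; (h + e)%N] [:: h].
have := signed_form_le0 [:: 0%N] [:: h; (h + e)%N].
have he : h%:Z - (h + e)%N%:Z = - e%:Z by rewrite PoszD; ring.
have eh : (h + e)%N%:Z - h%:Z = e%:Z by rewrite PoszD; ring.
rewrite /form !big_cons !big_nil !subrr !sub0r !subr0 he eh !c_even c0 ch; lia.
Qed.

(** As in [c_shift_neg], with the isotropic vector (1, 1, 0). *)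
Lemma c_shift_pos (h e : nat) : c h%:Z = 1 -> c (h + e)%N%:Z = - c e%:Z.
Proof.
move=> ch.
have := signed_form_le0 [:: 0%N; h; (h + e)%N] [::].
have := signed_form_le0 [:: 0%N; h] [:: (h + e)%N].
have he : h%:Z - (h + e)%N%:Z = - e%:Z by rewrite PoszD; ring.
have eh : (h + e)%N%:Z - h%:Z = e%:Z by rewrite PoszD; ring.
rewrite /form !big_cons !big_nil !subrr !sub0r !subr0 he eh !c_even c0 ch; lia.
Qed.

(** If [c h = -1], then [h] is a period and every value of [c] is at most 0,
    against the mean being zero.  So [c h = 1], and [c] changes sign from one
    multiple of [h] to the next while vanishing elsewhere. *)
Lemma c_classification (h : nat) : (0 < h)%N ->
  (forall d : nat, (0 < d < h)%N -> c d%:Z = 0) -> c h%:Z != 0 ->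
  forall d : nat, c d%:Z = (h %| d)%N%:Z - 2 * (2 * h %| d)%N%:Z.
Proof.
move=> h0 csmall ch.
have ch1 : c h%:Z = 1.
  have [//|ch1] : c h%:Z = 1 \/ c h%:Z = -1 by have := c_le1 h; lia.
  have c_le d : c d%:Z <= 0.
    elim/ltn_ind: d => d IH; have [dh|hd] := ltnP d h.
      by case: d dh {IH} => [|d] dh; rewrite ?c0 // csmall.
    rewrite -(subnKC hd) c_shift_neg //; apply: IH.
    by lia.
  suff : \sum_(0 <= d < M) c (0 + d%:Z) < 0 by rewrite c_mean.
  rewrite big_ltn // addr0 c0 (@le_lt_trans _ _ (-1)) // gerDl.
  by apply: sumr_le0 => d _; rewrite add0r.
elim/ltn_ind=> d IH; have [dh|hd] := ltnP d h.
  case: d dh {IH} => [|d] dh; first by rewrite !dvdn0 c0.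
  by rewrite csmall // !gtnNdvd //; lia.
rewrite -(subnKC hd) c_shift_pos // IH; last by lia.
move: (d - h)%N => e; rewrite dvdn_addr //.
have [/dvdnP[q ->]|hNe] := boolP (h %| e)%N.
  by rewrite -mulSn !dvdn_pmul2r // !dvdn2 /=; case: (odd q).
have nd m : ~~ (h %| m)%N -> (2 * h %| m)%N = false.
  by move=> hm; apply: contraNF hm; apply: dvdn_trans; exact: dvdn_mull.
by rewrite !nd // dvdn_addr.
Qed.

End QuadraticForm.

(** * The divisor-counting function *)

Definition count_divisors (s : seq nat) (n : nat) : nat := count (dvdn^~ n) s.

Lemma count_divisors_sum s m : (0 < m)%N ->
  count_divisors s m = (\sum_(0 <= e < m.+1 | e %| m) count_mem e s)%N.
Proof.
move=> m0; elim: s => [|x s IH] /=; first by rewrite big1.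
rewrite big_split /= -IH; congr addn.
rewrite -big_mkcondr /= sum1_count.
rewrite (eq_count (a2 := fun e => (x %| m)%N && (e == x))).
  have [xm|_] := boolP (x %| m)%N; last by rewrite count_pred0.
  by rewrite count_uniq_mem ?iota_uniq // mem_index_iota ltnS (dvdn_leq m0 xm).
by move=> e; rewrite eq_sym; case: eqP => [->|] //; rewrite !andbF.
Qed.

(** The multiplicity of [m] is recovered by induction: subtract from the number
    of members dividing [m] those that are proper divisors of [m]. *)
Lemma count_divisors_inj s t : 0%N \notin s -> 0%N \notin t ->
  (forall d, (0 < d)%N -> count_divisors s d = count_divisors t d) ->
  perm_eq s t.
Proof.
move=> s0 t0 eqd; apply/allP => m _; apply/eqP => /=.
elim/ltn_ind: m => -[|m] IH.
  by rewrite (count_memPn s0) (count_memPn t0).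
have := eqd m.+1 isT; rewrite !count_divisors_sum //.
rewrite !(big_mkcond (fun e => e %| _)%N) !(big_nat_recr m.+1) //= dvdnn.
rewrite (@eq_big_nat _ _ _ _ _ _
  (fun e => if (e %| m.+1)%N then count_mem e t else 0%N)); first exact: addnI.
by move=> e /andP[_ em]; rewrite IH.
Qed.

(** Exactly one [t] in a period is congruent to [- z]. *)
Lemma sum_dvdz_period (z : int) m : (0 < m)%N ->
  (\sum_(0 <= t < m) (m%:Z %| (z + t%:Z)%R)%Z = 1)%N.
Proof.
move=> m0; have mz : m%:Z != 0 by lia.
pose t0 := absz (- z %% m)%Z.
have t0E : t0%:Z = (- z %% m)%Z by rewrite gez0_abs // modz_ge0.
rewrite -big_mkcond sum1_count (@eq_in_count _ _ (pred1 t0)) => [|t].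
  rewrite count_uniq_mem ?iota_uniq // mem_index_iota /=.
  by rewrite -ltz_nat t0E ltz_pmod.
rewrite mem_index_iota /= => tm; rewrite -eqz_nat t0E.
rewrite -[X in _ = (X == _)](@modz_small _ m%:Z) ?ltz_nat //.
by rewrite eqz_mod_dvd opprK addrC.
Qed.

Lemma sum_dvdz (z : int) m M : (0 < m)%N -> (m %| M)%N ->
  (\sum_(0 <= t < M) (m%:Z %| (z + t%:Z)%R)%Z = M %/ m)%N.
Proof.
move=> m0 /dvdnP[q ->]; rewrite mulnK // big_nat_mul.
rewrite (eq_bigr (fun=> 1%N)) ?sum_nat_const_nat ?subn0 ?muln1 // => i _.
rewrite -(sum_dvdz_period (z + (i * m)%N%:Z) m0) mulSn -{1}[(i * m)%N]add0n.
rewrite big_addn addnK; apply: eq_bigr => t _.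
by rewrite addnC PoszD addrA.
Qed.

Section Excess.

Variables gs ds : seq nat.

Definition excess (z : int) : int :=
  (count_divisors gs `|z|)%:Z - (count_divisors ds `|z|)%:Z.

Lemma excess_even z : excess (- z) = excess z.
Proof. by rewrite /excess abszN. Qed.

Lemma excess_periodic M : {in gs ++ ds, forall r, r %| M}%N ->
  forall z, excess (z + M%:Z) = excess z.
Proof.
move=> rM z; have per s : {subset s <= gs ++ ds} ->
    count_divisors s `|(z + M%:Z)%R|%N = count_divisors s `|z|%N.
  move=> ss; apply: eq_in_count => r /ss/rM rdM.
  have rdMz : M%:Z \in dvdz r by [].
  exact: (rpredDr z rdMz).
by rewrite /excess !per // => r rs; rewrite mem_cat rs ?orbT.
Qed.

Lemma excess_mean M :
  {in gs ++ ds, forall r, (0 < r)%N && (r %| M)}%N -> (0 < M)%N ->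
  \sum_(g <- gs) 1 / g%:R = \sum_(d <- ds) 1 / d%:R :> rat ->
  forall z, \sum_(0 <= t < M) excess (z + t%:Z) = 0.
Proof.
move=> rM M0 sum_eq z.
have sumE s : {subset s <= gs ++ ds} ->
    (\sum_(0 <= t < M) (count_divisors s `|(z + t%:Z)%R|%N)%:Z)%:~R
    = M%:R * \sum_(r <- s) 1 / r%:R :> rat.
  move=> ss; rewrite -(big_morph Posz PoszD erefl) -pmulrn.
  have -> : (\sum_(0 <= t < M) count_divisors s `|(z + t%:Z)%R|
             = \sum_(r <- s) M %/ r)%N.
    rewrite (eq_bigr (fun t : nat => \sum_(r <- s) (r%:Z %| (z + t%:Z)%R)%Z)%N).
      rewrite exchange_big; apply: eq_big_seq => r /ss/rM /andP[r0 rdM].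
      exact: sum_dvdz.
    by move=> t _; rewrite /count_divisors -sum1_count big_mkcond.
  rewrite natr_sum mulr_sumr; apply: eq_big_seq => r.
  move=> /ss/rM /andP[r0 /dvdnP[q ->]].
  rewrite mulnK // natrM mul1r mulfK // pnatr_eq0; lia.
rewrite /excess sumrB; apply: (@intr_inj rat).
rewrite rmorphB /= !sumE ?sum_eq ?subrr // => r rs; by rewrite mem_cat rs ?orbT.
Qed.

Lemma gap_sum_count_divisors s S : gap_sum S (fun n => (count_divisors s n)%:Z)
  = (\sum_(r <- s) gap_sum S (fun n => nat_of_bool (r %| n)))%N%:Z.
Proof.
rewrite /gap_sum exchange_big (big_morph Posz PoszD erefl) /=.
apply: eq_bigr => x _; rewrite exchange_big (big_morph Posz PoszD erefl) /=.
by apply: eq_bigr => y _; rewrite /count_divisors -sum1_count big_mkcond.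
Qed.

Hypothesis gs_gt0 : all (ltn 0) gs.
Hypothesis ds_gt0 : all (ltn 0) ds.
Hypothesis disj : {in gs, forall r, r \notin ds}.

Lemma excess_ge0 S :
  (forall la, is_partition la ->
     \prod_(d <- ds) hook_prod d la %| \prod_(g <- gs) hook_prod g la)%N ->
  uniq S -> 0%N \notin S -> 0 <= gap_sum S (fun n => excess n%:Z).
Proof.
move=> dvdH uS S0; have -> : gap_sum S (fun n => excess n%:Z) =
    gap_sum S (fun n => (count_divisors gs n)%:Z)
    - gap_sum S (fun n => (count_divisors ds n)%:Z).
  by rewrite /gap_sum -sumrB; apply: eq_bigr => x _; rewrite -sumrB.
by rewrite !gap_sum_count_divisors subr_ge0 lez_nat gap_count_le.
Qed.

(** The least member of [gs ++ ds] belongs to only one of the two lists, so its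
    contribution to [excess] is not cancelled, and nothing smaller has a
    divisor in either list. *)
Lemma excess_first_nonzero : gs ++ ds != [::] -> exists h : nat, [/\ (0 < h)%N,
  forall d : nat, (0 < d < h)%N -> excess d%:Z = 0 & excess h%:Z != 0].
Proof.
move=> ne; have exh : exists h, h \in gs ++ ds.
  by case: (gs ++ ds) ne => // x s _; exists x; rewrite mem_head.
have [h hin hmin] := ex_minnP exh.
have gt0 r : r \in gs ++ ds -> (0 < r)%N.
  by rewrite mem_cat => /orP[/(allP gs_gt0)|/(allP ds_gt0)].
have count_divisors0 s d : {subset s <= gs ++ ds} -> (0 < d <= h)%N ->
    d \notin s -> count_divisors s d = 0%N.
  move=> ss /andP[d0 dh] ds'; apply/eqP; rewrite -leqn0 leqNgt -has_count.
  apply/hasPn => r rs; apply/negP => /(dvdn_leq d0) rd.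
  have rE : r = d by have := hmin r (ss r rs); lia.
  by rewrite -rE rs in ds'.
have subg : {subset gs <= gs ++ ds} by move=> r rs; rewrite mem_cat rs.
have subd : {subset ds <= gs ++ ds} by move=> r rs; rewrite mem_cat rs orbT.
have pos s : h \in s -> (0 < count_divisors s h)%N.
  by move=> hs; rewrite -has_count; apply/hasP; exists h.
have h0 := gt0 h hin.
exists h; split=> // [d /andP[d0 dh]|].
  have nin s : {subset s <= gs ++ ds} -> d \notin s.
    by move=> ss; apply/negP => /ss/hmin; lia.
  by rewrite /excess /= !count_divisors0 ?nin // d0 ltnW.
have hh : (0 < h <= h)%N by rewrite h0 leqnn.
rewrite /excess subr_eq0 eqz_nat /=; case: (boolP (h \in gs)) => hg.
  by rewrite (count_divisors0 ds) ?disj // -lt0n pos.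
have hd : h \in ds by move: hin; rewrite mem_cat (negbTE hg).
by rewrite (count_divisors0 gs) // eq_sym -lt0n pos.
Qed.

End Excess.

(** * Proof of the theorem *)

Lemma hook_prods_dvd (K L : nat) (gamma : K.-tuple nat) (delta : L.-tuple nat)
    la :
  all (ltn 0) delta ->
  hook_ratio gamma delta la \is a Num.int ->
  (\prod_(d <- delta) hook_prod d la %| \prod_(g <- gamma) hook_prod g la)%N.
Proof.
move=> ds_gt0; rewrite /hook_ratio.
rewrite -!(big_tuple _ _ _ xpredT (fun r => (hook_prod r la)%:R : rat)) /=.
rewrite -!natr_prod; set A := \prod_(i <- gamma) _.
set D := \prod_(i <- delta) _.
have D0 : (0 < D)%N.
  rewrite /D big_seq; apply big_ind => // [x y|r /(allP ds_gt0) r0].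
    by rewrite muln_gt0 => ->.
  exact: hook_prod_gt0.
case/intrP => m; move/(canRL (mulfVK _)); rewrite pnatr_eq0 -lt0n => /(_ D0).
rewrite (pmulrn _ D) (pmulrn _ A) -intrM => /intr_inj AmD.
have : (D%:Z %| A%:Z)%Z by rewrite AmD dvdz_mull.
by rewrite dvdzE.
Qed.

Theorem theorem4 (K L : nat) (gamma : K.-tuple nat) (delta : L.-tuple nat)
    (gamma_gt0 : forall k : 'I_K, (0 < tnth gamma k)%N)
    (delta_gt0 : forall l : 'I_L, (0 < tnth delta l)%N)
    (gamma_neq_delta :
       forall (k : 'I_K) (l : 'I_L), tnth gamma k <> tnth delta l)
    (ratio_int : forall la : seq nat,
       is_partition la -> hook_ratio gamma delta la \is a Num.int)
    (sum_eq : \sum_(k < K) 1 / (tnth gamma k)%:R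
              = \sum_(l < L) 1 / (tnth delta l)%:R :> rat)
    (LK : L%:Z - K%:Z = 1) :
  [/\ K = 1%N, L = 2%N
    & forall (k : 'I_K) (l : 'I_L), (2 * tnth gamma k)%N = tnth delta l].
Proof.
have gs_gt0 : all (ltn 0) gamma by apply/all_tnthP.
have ds_gt0 : all (ltn 0) delta by apply/all_tnthP.
have disj : {in gamma, forall r, r \notin (delta : seq nat)}.
  move=> r /tnthP[k ->]; apply/tnthP => -[l]; exact: gamma_neq_delta.
have dvdH la : is_partition la ->
    (\prod_(d <- delta) hook_prod d la %| \prod_(g <- gamma) hook_prod g la)%N.
  by move=> pla; apply: hook_prods_dvd => //; exact: ratio_int.
have sum_eq' : \sum_(g <- gamma) 1 / g%:R = \sum_(d <- delta) 1 / d%:R :> rat.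
  by rewrite !big_tuple.
pose M := (\prod_(r <- gamma ++ delta) r)%N.
have rM : {in gamma ++ delta, forall r, (0 < r)%N && (r %| M)}%N.
  move=> r rs; rewrite /M (big_rem r rs) dvdn_mulr // andbT.
  by move: rs; rewrite mem_cat => /orP[/(allP gs_gt0)|/(allP ds_gt0)].
have M0 : (0 < M)%N.
  rewrite /M big_seq; apply big_ind => // [x y|r /rM/andP[] //].
  by rewrite muln_gt0 => ->.
have ne : gamma ++ delta != [::] :> seq nat.
  by rewrite -size_eq0 size_cat !size_tuple; lia.
have [h [h0 hsmall hne]] := excess_first_nonzero gs_gt0 ds_gt0 disj ne.
have c0 : excess gamma delta 0 = -1.
  have cnt (s : seq nat) : count_divisors s 0 = size s.
    by apply/eqP; rewrite -all_count; apply/allP => r _; rewrite dvdn0.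
  by rewrite /excess !cnt !size_tuple; lia.
have excessE := c_classification M0 (excess_even gamma delta)
  (excess_periodic (fun r rs => proj2 (andP (rM r rs))))
  (excess_mean rM M0 sum_eq')
  (fun S => excess_ge0 gs_gt0 ds_gt0 dvdH) c0 h0 hsmall hne.
have not0 (s : seq nat) : all (ltn 0) s -> 0%N \notin s.
  by move=> s0; apply/negP => /(allP s0).
have perm : perm_eq (gamma ++ [:: (2 * h)%N; (2 * h)%N]) (h :: delta).
  apply: count_divisors_inj => [||d d0].
  - by rewrite not0 // all_cat gs_gt0 /= muln_gt0 h0.
  - by rewrite not0 //= h0 ds_gt0.
  have := excessE d; rewrite /excess /count_divisors count_cat /=; lia.
have cntE m : (count_mem m gamma + 2 * (m == 2 * h) =
               (m == h) + count_mem m delta)%N.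
  have /permP/(_ (pred1 m)) := perm; rewrite count_cat /= ![_ == m]eq_sym; lia.
have disjE m : (count_mem m gamma == 0)%N || (count_mem m delta == 0)%N.
  case: (boolP (m \in (gamma : seq nat))) => mg.
    by rewrite (count_memPn (disj m mg)) orbT.
  by rewrite (count_memPn mg).
have gE m : count_mem m gamma = (m == h).
  by have := cntE m; have := disjE m; case: (m =P h); case: (m =P _)%N; lia.
have dE m : count_mem m delta = (2 * (m == 2 * h))%N.
  by have := cntE m; rewrite gE; lia.
have gperm : perm_eq gamma [:: h].
  by apply/allP => m _; apply/eqP; rewrite [LHS]gE /= addn0 eq_sym.
have dperm : perm_eq delta [:: (2 * h)%N; (2 * h)%N].
  by apply/allP => m _; apply/eqP; rewrite [LHS]dE /= eq_sym addn0 mul2n addnn.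
split.
- by have := perm_size gperm; rewrite size_tuple.
- by have := perm_size dperm; rewrite size_tuple.
move=> k l; have := mem_tnth k gamma; rewrite (perm_mem gperm) inE => /eqP ->.
by have := mem_tnth l delta; rewrite (perm_mem dperm) !inE orbb => /eqP ->.
Qed.
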